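(* Let $d\ge 1$ be an integer. For every finite (nonempty, simple) $d$-regular graph $G$ and every real $\lambda>0$, \[ \alpha_G(\lambda)\;\le\;\alpha_{K_{d,d}}(\lambda)\;=\;\frac{\lambda(1+\lambda)^{d-1}}{2(1+\lambda)^d-1}, \] where $\alpha_G(\lambda)$ is the occupancy fraction of the hard-core model on $G$ at fugacity $\lambda$. Moreover, the maximum is achieved only by disjoint unions of copies of $K_{d,d}$: if for some $\lambda>0$ equality holds, then $G$ is a disjoint union of copies of $K_{d,d}$.
   Context: For a finite graph $G$, let $\mathcal I$ be the set of all independent sets of $G$ (including the empty set), and let $P_G(\lambda)=\sum_{I\in\mathcal I}\lambda^{|I|}$ be the independence polynomial. The hard-core model with fugacity $\lambda$ on $G$ is the random independent set $I$ with $\Pr[I]=\lambda^{|I|}/P_G(\lambda)$. The occupancy fraction is the expected fraction of vertices of $G$ belonging to $I$: \[ \alpha_G(\lambda)=\frac{1}{|V(G)|}\sum_{v\in V(G)}\Pr[v\in I]=\frac{1}{|V(G)|}\frac{\lambda P_G'(\lambda)}{P_G(\lambda)}. \] $K_{d,d}$ denotes the complete bipartite graph with $d$ vertices in each part. *)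

(* Defs.v *)
From HB Require Import structures.
From mathcomp Require Import all_boot all_order all_algebra.
From mathcomp Require Import reals.

Set Implicit Arguments.
Unset Strict Implicit.
Unset Printing Implicit Defensive.

Import Order.TTheory GRing.Theory Num.Theory.
Local Open Scope ring_scope.

Record sgraph := SGraph {
  vert :> finType;
  adj : rel vert;
  adj_sym : symmetric adj;
  adj_irrefl : irreflexive adj }.

Definition regular (d : nat) (G : sgraph) : Prop :=
  forall v : G, #|[set w | adj v w]| = d.

Definition independent (G : sgraph) (I : {set G}) : bool :=
  [forall v in I, forall w in I, ~~ adj v w].

Section HardCore.
Variable R : realType.
Implicit Types (G : sgraph) (lambda : R).

Definition indep_poly G : {poly R} := \sum_(I : {set G} | independent I) 'X^#|I|.

Definition hc_mass G lambda (I : {set G}) : R :=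
  if independent I then lambda ^+ #|I| / (indep_poly G).[lambda] else 0.

Definition hc_prob G lambda (E : pred {set G}) : R :=
  \sum_(I : {set G} | E I) hc_mass lambda I.

(* On the empty graph the value is 0, since 0^-1 = 0. *)
Definition occupancy G lambda : R :=
  #|G|%:R^-1 * \sum_(v : G) hc_prob lambda (fun I : {set G} => v \in I).

Lemma indep_polyE G lambda :
  (indep_poly G).[lambda] = \sum_(I : {set G} | independent I) lambda ^+ #|I|.
Proof.
by rewrite /indep_poly horner_sum; apply: eq_bigr => I _; rewrite hornerXn.
Qed.

Lemma occupancyE G lambda :
  occupancy G lambda =
  #|G|%:R^-1 * (lambda * (indep_poly G)^`().[lambda] / (indep_poly G).[lambda]).
Proof.
rewrite /occupancy /hc_prob; congr (_ * _).
rewrite (exchange_big_dep predT) //=.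
transitivity (\sum_(I : {set G} | independent I)
    #|I|%:R * lambda ^+ #|I| / (indep_poly G).[lambda]).
  rewrite [RHS]big_mkcond; apply: eq_bigr => I _; rewrite sumr_const /hc_mass.
  by case: ifP => _; rewrite ?mul0rn // -mulrA mulr_natl.
rewrite -mulr_suml; congr (_ / _).
rewrite [in RHS]/indep_poly raddf_sum /= horner_sum mulr_sumr.
apply: eq_bigr => I _; rewrite derivXn hornerMn hornerXn.
case: #|I| => [|n]; first by rewrite mul0r mulr0n mulr0.
by rewrite mulrnAr -exprS mulr_natl.
Qed.

End HardCore.

Definition Kbip_adj (d : nat) : rel ('I_d + 'I_d)%type :=
  fun x y => match x, y with
             | inl _, inr _ | inr _, inl _ => true
             | _, _ => false
             end.

Lemma Kbip_sym d : symmetric (@Kbip_adj d).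
Proof. by case=> x [] y. Qed.

Lemma Kbip_irrefl d : irreflexive (@Kbip_adj d).
Proof. by case. Qed.

Definition Kbip (d : nat) : sgraph := SGraph (@Kbip_sym d) (@Kbip_irrefl d).

Definition copies_adj (n : nat) (H : sgraph) : rel ('I_n * H)%type :=
  fun x y => (x.1 == y.1) && adj x.2 y.2.

Lemma copies_sym n H : symmetric (@copies_adj n H).
Proof. by move=> x y; rewrite /copies_adj eq_sym adj_sym. Qed.

Lemma copies_irrefl n H : irreflexive (@copies_adj n H).
Proof. by move=> x; rewrite /copies_adj adj_irrefl andbF. Qed.

Definition copies (n : nat) (H : sgraph) : sgraph :=
  SGraph (@copies_sym n H) (@copies_irrefl n H).

Definition isomorphic (G H : sgraph) : Prop :=
  exists2 f : G -> H, bijective f & forall x y, adj (f x) (f y) = adj x y.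

Definition disjoint_union_of (H G : sgraph) : Prop :=
  exists n : nat, isomorphic G (copies n H).

(* Main.v *)
Require Import Defs.
From mathcomp Require Import all_boot all_order all_algebra.
From mathcomp Require Import reals.
From mathcomp Require Import ring lra.

Set Implicit Arguments.
Unset Strict Implicit.
Unset Printing Implicit Defensive.

Import Order.TTheory GRing.Theory Num.Theory.
Local Open Scope ring_scope.

(** Fix a vertex [v] with neighbourhood [N] and reveal the random independent set
    [I] outside [N], obtaining [J].  The sets [K = I :&: N] still allowed form a
    down-closed family [F] of subsets of [N], weighted by [lambda ^+ #|K|].  Double
    counting gives [(k+1) p_(k+1) <= (d-k) p_k] for the number [p_k] of [k]-sets in
    [F], so [p_k / 'C(d, k)] is nonincreasing and, by Chebyshev's sum inequality,
    the mean of [#|K|] given [K != set0] is at most its value for the full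
    powerset.  Combining this over all [J] and [v] with
    [\sum_v #|I :&: N(v)| = d #|I|] and
    [lambda Pr(I :&: N(v) = set0) = (1 + lambda) Pr(v \in I)]
    is exactly the upper bound on the occupancy fraction.  In [K_{d,d}] each family
    is either trivial or the full powerset, so equality holds.  Conversely, equality
    forces every family with a nonempty member to contain [N]; taking [J = set0] and
    [J = [set u]] shows that vertices with a common neighbour have the same
    neighbourhood, so the components are copies of [K_{d,d}]. *)

(** * Level sizes of a down-closed family *)

Section Layers.
Variables (T : finType) (N : {set T}).
Implicit Types (F : pred {set T}) (A B K : {set T}).

Definition down_closed F := forall A B, A \subset B -> F B -> F A.

Definition layer F k := #|[set K : {set T} | [&& K \subset N, F K & #|K| == k]]|.

Lemma layer_predT k : layer predT k = 'C(#|N|, k).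
Proof. by rewrite -cards_draws; apply: eq_card => K; rewrite !inE. Qed.

(** Both sides count pairs of a member of [F] and an element of [N]: deleting [x] sends the pairs
    with [x \in K] at level [k.+1] injectively to pairs with [x \notin K] at level [k]. *)
Lemma layer_step F k : down_closed F ->
  (layer F k.+1 * k.+1 <= layer F k * (#|N| - k))%N.
Proof.
move=> dF; rewrite /layer -!sum_nat_const.
set L1 := [set K | _]; set L0 := [set K | _].
have -> : (\sum_(K in L1) k.+1 = \sum_(x in N) \sum_(K in L1 | x \in K) 1)%N.
  rewrite (exchange_big_dep (mem L1)) /=; last by move=> x K _ /andP[].
  apply: eq_bigr => K KL; have := KL; rewrite {1}inE => /and3P[KN _ /eqP <-].
  rewrite sum1_card; apply: eq_card => x; rewrite [in RHS]unfold_in /= KL /=.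
  by apply/idP/andP => [xK|[]//]; split=> //; apply: (subsetP KN).
have -> : (\sum_(K in L0) (#|N| - k) = \sum_(x in N) \sum_(K in L0 | x \notin K) 1)%N.
  rewrite (exchange_big_dep (mem L0)) /=; last by move=> x K _ /andP[].
  apply: eq_bigr => K KL; have := KL; rewrite {1}inE => /and3P[KN _ /eqP <-].
  rewrite sum1_card -cardsDS //; apply: eq_card => x.
  by rewrite inE [in RHS]unfold_in /= KL andbC.
apply: leq_sum => x xN; rewrite !sum1_card.
rewrite -[leqRHS]cardsE -[leqLHS]cardsE.
have injD : {in [set K | (K \in L1) && (x \in K)] &, injective (fun K => K :\ x)}.
  move=> A B; rewrite !inE => /andP[_ xA] /andP[_ xB] eAB.
  by rewrite -(setD1K xA) eAB setD1K.
rewrite -(card_in_imset injD); apply: subset_leq_card.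
apply/subsetP => _ /imsetP[A +  ->]; rewrite !inE => /andP[/and3P[AN FA cA] xA].
rewrite unfold_in /= !inE eqxx andbT (subset_trans (subD1set _ _) AN) (dF _ A) ?subD1set //=.
by move: cA; rewrite (cardsD1 x A) xA.
Qed.

(** Iterates [layer_step], whose analogue for the binomial coefficients is an equality.
    Cross-multiplication replaces the ratios [layer N F k / 'C(#|N|, k)]. *)
Lemma layer_ratio F j k : down_closed F -> (j <= k <= #|N|)%N ->
  (layer F k * 'C(#|N|, j) <= layer F j * 'C(#|N|, k))%N.
Proof.
move=> dF /andP[]; elim: k => [|k IHk]; first by rewrite leqn0 => /eqP ->.
rewrite leq_eqVlt => /predU1P[-> //|]; rewrite ltnS => jk kN.
rewrite -(@leq_pmul2r k.+1) // mulnAC.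
apply: leq_trans (leq_mul (layer_step k dF) (leqnn _)) _.
rewrite -[leqRHS]mulnA [('C(_, k.+1) * _)%N]mulnC mul_bin_left.
rewrite mulnAC [leqRHS]mulnCA [leqRHS]mulnC.
by rewrite leq_mul // IHk // ltnW.
Qed.

Lemma sum_layer (V : nmodType) F (f : nat -> V) :
  \sum_(K : {set T} | (K \subset N) && F K) f #|K| =
  \sum_(k < #|N|.+1) f k *+ layer F k.
Proof.
rewrite (partition_big (fun K => inord #|K| : 'I_#|N|.+1) predT) //=.
apply: eq_bigr => k _; rewrite /layer -sumr_const.
apply: eq_big => [K|K].
  rewrite inE -andbA; apply: andb_id2l => KN; congr (_ && _).
  by rewrite -val_eqE /= inordK // ltnS subset_leq_card.
by case/andP=> /andP[KN _] /eqP <-; rewrite inordK // ltnS subset_leq_card.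
Qed.

(** Removing level 0 leaves the sizes 1 to [#|N|], so index [k] stands for size [k.+1]; hence the
    weights [k.+1] in the Chebyshev sums. *)
Lemma sum_layer_neq0 (V : nmodType) F (f : nat -> V) :
  \sum_(K : {set T} | [&& K \subset N, F K & K != set0]) f #|K| =
  \sum_(k < #|N|) f k.+1 *+ layer F k.+1.
Proof.
under eq_bigl => K do rewrite andbA.
transitivity (\sum_(K : {set T} | (K \subset N) && F K)
                 if #|K| == 0%N then 0 else f #|K|).
  rewrite big_mkcondr; apply: eq_bigr => K _.
  by rewrite cards_eq0; case: eqP.
rewrite (sum_layer F (fun k => if k == 0%N then 0 else f k)).
by rewrite big_ord_recl /= mul0rn add0r.
Qed.

End Layers.

(** * Chebyshev's sum inequality and its equality case *)

Section Chebyshev.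
Variables (R : realFieldType) (n : nat) (p q : nat -> R).
Hypothesis ratio : forall j k, (j <= k < n)%N -> p k * q j <= p j * q k.

Let term (j k : 'I_n) : R := (j%:R - k%:R) * (p k * q j - p j * q k).

Let term_ge0 j k : 0 <= term j k.
Proof.
rewrite /term; case: (leqP j k) => jk.
  by rewrite mulr_le0 // subr_le0 ?ler_nat // ratio // jk /=.
by rewrite mulr_ge0 // subr_ge0 ?ler_nat ?(ltnW jk) // ratio // (ltnW jk) /=.
Qed.

(** Symmetrisation: the factor 2 supplies a second copy with [j] and [k] exchanged, and paired terms
    combine into products whose two factors never have opposite signs, by [ratio]. *)
Let chebyshevE :
  2 * ((\sum_(j < n) j.+1%:R * q j) * (\sum_(k < n) p k)
       - (\sum_(j < n) q j) * (\sum_(k < n) k.+1%:R * p k)) =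
  \sum_(j < n) \sum_(k < n) term j k.
Proof.
rewrite !mulr_suml; under eq_bigr do rewrite mulr_sumr.
under [X in _ - X]eq_bigr do rewrite mulr_sumr.
rewrite -sumrB; under eq_bigr do rewrite -sumrB.
rewrite mulr_natl mulr2n {1}exchange_big /= -big_split /=.
apply: eq_bigr => j _; rewrite -big_split /=; apply: eq_bigr => k _.
by rewrite /term -!natr1; ring.
Qed.

Lemma chebyshev_ge0 :
  0 <= (\sum_(j < n) j.+1%:R * q j) * (\sum_(k < n) p k)
       - (\sum_(j < n) q j) * (\sum_(k < n) k.+1%:R * p k).
Proof.
rewrite -(@pmulr_rge0 _ 2) // chebyshevE.
by apply: sumr_ge0 => j _; apply: sumr_ge0 => k _.
Qed.

Lemma chebyshev_eq0 :
  (\sum_(j < n) j.+1%:R * q j) * (\sum_(k < n) p k)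
    - (\sum_(j < n) q j) * (\sum_(k < n) k.+1%:R * p k) = 0 ->
  forall j k, (j < n)%N -> (k < n)%N -> p k * q j = p j * q k.
Proof.
move=> E j k jn kn; have /esym := chebyshevE; rewrite E mulr0 => /eqP.
rewrite psumr_eq0 => [/allP /(_ (Ordinal jn) (mem_index_enum _)) /= H|i _]; last first.
  exact: sumr_ge0.
move: H; rewrite psumr_eq0 // => /allP /(_ (Ordinal kn) (mem_index_enum _)) /=.
rewrite /term /= mulf_eq0 !subr_eq0 eqr_nat => /orP[/eqP -> //|/eqP //].
Qed.

End Chebyshev.

(** * Comparison of a down-closed family with the full powerset *)

Section Gap.
Variables (R : realFieldType) (T : finType) (l : R) (N : {set T}).
Hypothesis l0 : 0 < l.
Implicit Types (F : pred {set T}) (K : {set T}).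

(* The cross-multiplied difference between the mean sizes of a nonempty random set
   in the powerset of [N] and in [F], where [A] has weight [l ^+ #|A|]. *)
Definition gap F : R :=
  (\sum_(A : {set T} | A \subset N) #|A|%:R * l ^+ #|A|)
    * (\sum_(K : {set T} | [&& K \subset N, F K & K != set0]) l ^+ #|K|)
  - (\sum_(A : {set T} | (A \subset N) && (A != set0)) l ^+ #|A|)
    * (\sum_(K : {set T} | (K \subset N) && F K) #|K|%:R * l ^+ #|K|).

Lemma sum_sizes_neq0 F :
  \sum_(K : {set T} | (K \subset N) && F K) #|K|%:R * l ^+ #|K| =
  \sum_(k < #|N|) k.+1%:R * (l ^+ k.+1 *+ layer N F k.+1).
Proof.
rewrite (sum_layer N F (fun k => k%:R * l ^+ k)) big_ord_recl /= mul0r mul0rn add0r.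
by apply: eq_bigr => k _; rewrite mulrnAr.
Qed.

Lemma gapE F : gap F =
  (\sum_(j < #|N|) j.+1%:R * (l ^+ j.+1 *+ 'C(#|N|, j.+1)))
    * (\sum_(k < #|N|) l ^+ k.+1 *+ layer N F k.+1)
  - (\sum_(j < #|N|) l ^+ j.+1 *+ 'C(#|N|, j.+1))
    * (\sum_(k < #|N|) k.+1%:R * (l ^+ k.+1 *+ layer N F k.+1)).
Proof.
rewrite /gap sum_sizes_neq0 (sum_layer_neq0 N F (fun k => l ^+ k)).
congr (_ * _ - _ * _).
  rewrite (eq_bigl (fun A : {set T} => (A \subset N) && predT A)); last by move=> A; rewrite andbT.
  rewrite (sum_sizes_neq0 predT).
  by apply: eq_bigr => j _; rewrite layer_predT.
rewrite (sum_layer_neq0 N predT (fun k => l ^+ k)).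
by apply: eq_bigr => j _; rewrite layer_predT.
Qed.

Lemma gap_ratio F : down_closed F -> forall j k, (j <= k < #|N|)%N ->
  (l ^+ k.+1 *+ layer N F k.+1) * (l ^+ j.+1 *+ 'C(#|N|, j.+1)) <=
  (l ^+ j.+1 *+ layer N F j.+1) * (l ^+ k.+1 *+ 'C(#|N|, k.+1)).
Proof.
move=> dF j k jk; rewrite !(mulrnAl, mulrnAr) -!mulrnA [l ^+ j.+1 * _]mulrC.
rewrite ler_pMn2l ?mulr_gt0 ?exprn_gt0 //.
by rewrite mulnC [leqRHS]mulnC layer_ratio.
Qed.

Lemma gap_ge0 F : down_closed F -> 0 <= gap F.
Proof.
move=> dF; rewrite gapE.
by apply: (chebyshev_ge0 (p := fun k => l ^+ k.+1 *+ layer N F k.+1)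
  (q := fun k => l ^+ k.+1 *+ 'C(#|N|, k.+1))); apply: gap_ratio.
Qed.

(** Equality in Chebyshev is read between sizes 1 and [#|N|]: a nonempty member yields a singleton
    in [F], so the top level is occupied, and only [N] can occupy it. *)
Lemma gap_eq0 F K : down_closed F -> gap F = 0 ->
  K \subset N -> K != set0 -> F K -> F N.
Proof.
move=> dF; rewrite gapE => g0 KN /set0Pn[x xK] FK.
have N0 : (0 < #|N|)%N by apply/card_gt0P; exists x; apply: (subsetP KN).
have Nlt : (#|N|.-1 < #|N|)%N by rewrite prednK.
have := chebyshev_eq0 (p := fun k => l ^+ k.+1 *+ layer N F k.+1)
  (q := fun k => l ^+ k.+1 *+ 'C(#|N|, k.+1)) (gap_ratio dF) g0 N0 Nlt.
rewrite /= prednK // binn mulr1n => E.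
have : 0 < l ^+ 1 *+ layer N F 1 * l ^+ #|N|.
  rewrite mulr_gt0 ?pmulrn_lgt0 ?exprn_gt0 //.
  apply/card_gt0P; exists [set x]; rewrite inE sub1set (subsetP KN) //= cards1 eqxx.
  by rewrite (dF _ K) // sub1set.
rewrite -E; case: (posnP (layer N F #|N|)) => [->|]; first by rewrite mulr0n mul0r ltxx.
case/card_gt0P => A; rewrite inE => /and3P[AN FA cA] _.
have /eqP <- : A == N by rewrite eqEcard AN (eqP cA) /=.
exact: FA.
Qed.

Lemma gap_predT F : (forall K, K \subset N -> F K) -> gap F = 0.
Proof.
move=> FT; apply/eqP; rewrite subr_eq0 mulrC; apply/eqP.
by congr (_ * _); apply: eq_bigl => K; case: (boolP (K \subset N)) => [/FT ->|].
Qed.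

Lemma gap_pred0 F : (forall K, K \subset N -> F K -> K = set0) -> gap F = 0.
Proof.
move=> F0; rewrite /gap [X in _ * X - _]big1 => [|K /and3P[KN FK]]; last first.
  by rewrite (F0 K) ?eqxx.
rewrite mulr0 sub0r [X in _ * X]big1 ?mulr0 ?oppr0 // => K /andP[KN FK].
by rewrite (F0 K) // cards0 mul0r.
Qed.

Lemma sum_subsets : \sum_(A : {set T} | A \subset N) l ^+ #|A| = (1 + l) ^+ #|N|.
Proof.
rewrite (eq_bigl (fun A : {set T} => (A \subset N) && predT A)); last by move=> A; rewrite andbT.
rewrite (sum_layer N predT (fun k => l ^+ k)) exprDn.
by apply: eq_bigr => k _; rewrite layer_predT expr1n mul1r.
Qed.

Lemma sum_subsets_neq0 :
  \sum_(A : {set T} | (A \subset N) && (A != set0)) l ^+ #|A| = (1 + l) ^+ #|N| - 1.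
Proof.
by rewrite -sum_subsets [in RHS](bigD1 set0) ?sub0set //= cards0 expr0 [1 + _]addrC addrK.
Qed.

(** Termwise absorption [k.+1 * 'C(d.+1, k.+1) = d.+1 * 'C(d, k)], then the binomial theorem. *)
Lemma sum_subsets_size :
  \sum_(A : {set T} | A \subset N) #|A|%:R * l ^+ #|A| =
  #|N|%:R * l * (1 + l) ^+ #|N|.-1.
Proof.
rewrite (eq_bigl (fun A : {set T} => (A \subset N) && predT A)); last by move=> A; rewrite andbT.
rewrite (sum_sizes_neq0 predT).
under eq_bigr do rewrite layer_predT.
case: #|N| => [|d]; first by rewrite big_ord0 !mul0r.
rewrite /= exprDn mulr_sumr; apply: eq_bigr => k _.
rewrite expr1n mul1r -[_ *+ _ in LHS]mulr_natr -[_ *+ _ in RHS]mulr_natr.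
have := congr1 (fun m : nat => m%:R : R) (mul_bin_diag d.+1 k); rewrite /= !natrM.
move=> E; transitivity (l * l ^+ k * (k.+1%:R * 'C(d.+1, k.+1)%:R)).
  by rewrite exprS; ring.
by rewrite -E; ring.
Qed.

End Gap.

(** * Decomposition of sets along [N] *)

Lemma sum_subset_split (V : nmodType) (T : finType) (N : {set T})
    (P : pred {set T}) (g : {set T} -> V) :
  \sum_(I : {set T} | P I) g I =
  \sum_(J : {set T} | J \subset ~: N)
    \sum_(K : {set T} | (K \subset N) && P (J :|: K)) g (J :|: K).
Proof.
rewrite (partition_big (fun I => I :\: N) (fun J => J \subset ~: N)) /=; last first.
  by move=> I _; rewrite setDE subsetIr.
apply: eq_bigr => J JN.
rewrite (reindex_onto (fun K => J :|: K) (fun I => I :&: N)) /=; last first.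
  by move=> I /andP[_ /eqP <-]; rewrite setUC setID.
apply: eq_bigl => K; rewrite -andbA andbC; congr (_ && _).
have JN0 : J :&: N = set0 by apply/eqP; rewrite setI_eq0 disjoints_subset.
rewrite setDUl setIUl JN0 set0U.
have -> : J :\: N = J by apply/setDidPl; rewrite -setI_eq0 JN0.
apply/andP/idP => [[_ /eqP/setIidPl]//|KN].
by move: (KN) => /setIidPl ->; move: KN; rewrite -setD_eq0 => /eqP ->; rewrite setU0.
Qed.

Section SplitOff.
Variables (T : finType) (N J K : {set T}).
Hypotheses (JN : J \subset ~: N) (KN : K \subset N).

Lemma setI_split : (J :|: K) :&: N = K.
Proof.
move: JN; rewrite -disjoints_subset -setI_eq0 => /eqP JN0.
by rewrite setIUl JN0 set0U; apply/setIidPl.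
Qed.

Lemma card_split : #|J :|: K| = (#|J| + #|K|)%N.
Proof.
move: JN; rewrite -disjoints_subset => JN'; apply/eqP.
by rewrite (leq_card_setU J K).2; apply: disjointWr JN'.
Qed.

End SplitOff.

(** * Neighbourhoods and the families left free by a revealed set *)

Definition neighbours (G : sgraph) (v : G) : {set G} := [set w | adj v w].

(** For [J] not independent the family is empty and its gap is 0, so sums may range over every [J]
    avoiding the neighbourhood. *)
Definition free_family (G : sgraph) (J : {set G}) : pred {set G} :=
  fun K => independent (J :|: K).

Lemma independentP (G : sgraph) (I : {set G}) :
  reflect {in I &, forall v w, ~~ adj v w} (independent I).
Proof.
apply: (iffP forallP) => [H v w vI wI|H v].
  by have /implyP/(_ vI)/forallP/(_ w)/implyP := H v; apply.
by apply/implyP => vI; apply/forallP => w; apply/implyP => wI; apply: H.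
Qed.

Lemma independentS (G : sgraph) (I I' : {set G}) :
  I \subset I' -> independent I' -> independent I.
Proof.
by move=> /subsetP sI /independentP H; apply/independentP => v w /sI vI /sI; apply: H.
Qed.

Lemma free_family_down_closed (G : sgraph) (J : {set G}) : down_closed (free_family J).
Proof. by move=> A B AB; apply: independentS; apply: setUS. Qed.

(** * The occupancy fraction as the extremal value minus a deficit *)

Section Deficit.
Variables (R : realType) (G : sgraph) (l : R).
Hypothesis l0 : 0 < l.

Let Z := \sum_(I : {set G} | independent I) l ^+ #|I|.
Let M := \sum_(I : {set G} | independent I) #|I|%:R * l ^+ #|I|.

Lemma partition_function_gt0 : 0 < Z.
Proof.
rewrite /Z (bigD1 set0) /=; last by apply/independentP => v w; rewrite inE.
by rewrite cards0 ltr_pwDl // sumr_ge0 // => I _; rewrite exprn_ge0 // ltW.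
Qed.

Lemma occupancy_mean : occupancy G l = M / (#|G|%:R * Z).
Proof.
rewrite /occupancy invfM mulrCA; congr (_ * _).
rewrite mulr_suml /hc_prob (exchange_big_dep predT) //=.
rewrite [RHS]big_mkcond; apply: eq_bigr => I _; rewrite sumr_const /hc_mass indep_polyE -/Z.
by case: ifP => _; rewrite ?mul0rn // -[LHS]mulr_natl mulrA.
Qed.

(* Adding [v] to or removing it from a set that misses its neighbourhood preserves
   independence. *)
Lemma sum_disjoint_neighbours (v : G) :
  l * \sum_(I : {set G} | independent I && (I :&: neighbours v == set0)) l ^+ #|I| =
  (1 + l) * \sum_(I : {set G} | independent I && (v \in I)) l ^+ #|I|.
Proof.
rewrite (bigID (fun I : {set G} => v \in I)) /=.
rewrite mulrDr addrC mulrDl mul1r; congr (_ + _).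
  rewrite mulr_sumr [RHS](reindex_onto (fun J => v |: J) (fun I => I :\ v)) /=; last first.
    by move=> I /andP[_ vI]; rewrite setD1K.
  apply: eq_big => [I|I /andP[_ vI]]; last by rewrite cardsU1 vI exprS.
  apply/andP/andP=> [[/andP[/independentP iI /eqP I0] vI]|[/andP[/independentP iI _] /eqP E]].
    rewrite setU1K ?eqxx // setU11 andbT; split=> //.
    have nI w : w \in I -> ~~ adj v w.
      by move=> wI; apply/negP => vw; have := in_set0 w; rewrite -I0 !inE wI vw.
    apply/independentP => x y; rewrite !inE => /predU1P[->|xI] /predU1P[->|yI].
    - by rewrite adj_irrefl.
    - exact: nI.
    - by rewrite adj_sym nI.
    - exact: iI.
  split; last by rewrite -E !inE eqxx.
  apply/andP; split.
    by apply/independentP => x y xI yI; apply: iI; apply/setU1P; right.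
  apply/eqP/setP => w; rewrite !inE; apply/negbTE/negP => /andP[wI].
  by apply/negP/iI; rewrite ?setU11 // setU1r.
congr (_ * _); apply: eq_bigl => I; rewrite -andbA; apply: andb_id2l => /independentP iI.
rewrite andbC; apply: andb_idr => vI; apply/eqP/setP => w; rewrite !inE.
by apply/negbTE/negP => /andP[wI]; apply/negP/iI.
Qed.

Lemma sum_members :
  \sum_(v : G) \sum_(I : {set G} | independent I && (v \in I)) l ^+ #|I| = M.
Proof.
rewrite (exchange_big_dep (@independent G)) /=; last by move=> v I _ /andP[].
apply: eq_bigr => I iI; rewrite iI /= sumr_const mulr_natl.
by congr (_ *+ _); apply: eq_card.
Qed.

(** Each [w \in I] is counted once for each of its [d] neighbours. *)
Lemma sum_neighbour_members d : regular d G ->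
  \sum_(v : G) \sum_(I : {set G} | independent I) #|I :&: neighbours v|%:R * l ^+ #|I|
  = d%:R * M.
Proof.
move=> reg; rewrite exchange_big mulr_sumr; apply: eq_bigr => I _ /=.
rewrite -mulr_suml mulrA; congr (_ * _); rewrite -natr_sum -natrM; congr _%:R.
transitivity (\sum_(v : G) \sum_(w in I) adj w v)%N.
  apply: eq_bigr => v _; rewrite -sum1_card [RHS]big_mkcond [LHS]big_mkcond /=.
  by apply: eq_bigr => w _; rewrite !inE adj_sym; case: (w \in I).
rewrite exchange_big /= mulnC -sum_nat_const; apply: eq_big => // w _.
by rewrite -(reg w) -sum1_card [RHS]big_mkcond; apply: eq_bigr => v _; rewrite inE.
Qed.

(** The factor [l ^+ #|J|] turns weights of [K] into weights of [J :|: K], so the gaps recombine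
    into sums over independent sets of [G]. *)
Definition local_deficit (v : G) : R :=
  \sum_(J : {set G} | J \subset ~: neighbours v)
    l ^+ #|J| * gap l (neighbours v) (free_family J).

Lemma local_deficitE (v : G) (d := #|neighbours v|) :
  local_deficit v =
  d%:R * l * (1 + l) ^+ d.-1 *
    (\sum_(I : {set G} | independent I && (I :&: neighbours v != set0)) l ^+ #|I|)
  - ((1 + l) ^+ d - 1) *
    \sum_(I : {set G} | independent I) #|I :&: neighbours v|%:R * l ^+ #|I|.
Proof.
rewrite (sum_subset_split (neighbours v)
  (fun I => independent I && (I :&: neighbours v != set0))) /=.
rewrite (sum_subset_split (neighbours v) (@independent G)) !mulr_sumr -sumrB.
apply: eq_bigr => J JN; rewrite /gap sum_subsets_size sum_subsets_neq0 mulrBr.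
rewrite mulrCA [X in _ - X]mulrCA; congr (_ * _ - _ * _); rewrite mulr_sumr.
  apply: eq_big => [K|K /andP[KN _]]; last by rewrite (card_split JN KN) exprD.
  by case: (boolP (K \subset _)) => // KN; rewrite (setI_split JN KN).
apply: eq_bigr => K /andP[KN _].
by rewrite (setI_split JN KN) (card_split JN KN) exprD mulrCA.
Qed.

Lemma local_deficit_ge0 (v : G) : 0 <= local_deficit v.
Proof.
apply: sumr_ge0 => J _; rewrite mulr_ge0 ?exprn_ge0 ?(ltW l0) //.
by apply: gap_ge0 => //; apply: free_family_down_closed.
Qed.

Lemma local_deficit_eq0 (v : G) : local_deficit v = 0 ->
  forall J K : {set G}, J \subset ~: neighbours v -> K \subset neighbours v ->
  K != set0 -> independent (J :|: K) -> independent (J :|: neighbours v).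
Proof.
move=> /eqP; rewrite psumr_eq0 => [/allP H J K JN KN K0 iJK|J _]; last first.
  rewrite mulr_ge0 ?exprn_ge0 ?(ltW l0) //.
  by apply: gap_ge0 => //; apply: free_family_down_closed.
have := H J (mem_index_enum _); rewrite JN /= mulf_eq0 expf_eq0 (gt_eqF l0) andbF /=.
move/eqP => g0; apply: (gap_eq0 l0 (@free_family_down_closed G J) g0 KN K0 iJK).
Qed.

Lemma sum_local_deficit d : (0 < d)%N -> regular d G ->
  \sum_(v : G) local_deficit v =
  d%:R * (l * (1 + l) ^+ (d - 1) * (#|G|%:R * Z) - (2 * (1 + l) ^+ d - 1) * M).
Proof.
(* The extra factor [l] lets [sum_disjoint_neighbours] trade sets missing the neighbourhood of [v]
   for sets containing [v]. *)
move=> d0 reg; apply: (mulfI (lt0r_neq0 l0)).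
under eq_bigr => v _.
  rewrite local_deficitE [#|neighbours v|]reg.
  have -> : \sum_(I : {set G} | independent I && (I :&: neighbours v != set0)) l ^+ #|I|
    = Z - \sum_(I : {set G} | independent I && (I :&: neighbours v == set0)) l ^+ #|I|.
    by rewrite /Z [X in X - _](bigID (fun I => I :&: neighbours v == set0)) /= addrC addrK.
  over.
rewrite sumrB -!mulr_sumr sumrB (sum_neighbour_members reg).
set U := \sum_(v : G) \sum_(I | _ && _) _.
have lU : l * U = (1 + l) * M.
  rewrite /U mulr_sumr; under eq_bigr do rewrite sum_disjoint_neighbours.
  by rewrite -mulr_sumr sum_members.
rewrite sumr_const -[Z *+ _]mulr_natl mulrBr [X in X - _]mulrCA mulrBr lU.
case: d d0 {reg} => // d _; rewrite subn1 /= exprS.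
by ring.
Qed.

(** Being an exact identity, it serves all three claims: nonnegative deficits give the bound, and
    vanishing deficits give the value for [Kbip d] and the equality case. *)
Lemma occupancy_deficit d : (0 < d)%N -> regular d G -> (0 < #|G|)%N ->
  occupancy G l = l * (1 + l) ^+ (d - 1) / (2 * (1 + l) ^+ d - 1)
    - (\sum_(v : G) local_deficit v)
        / (d%:R * (2 * (1 + l) ^+ d - 1) * (#|G|%:R * Z)).
Proof.
move=> d0 reg G0; rewrite (sum_local_deficit d0 reg) occupancy_mean.
have Z0 := lt0r_neq0 partition_function_gt0.
have nG : #|G|%:R != 0 :> R by rewrite pnatr_eq0 -lt0n.
have nd : d%:R != 0 :> R by rewrite pnatr_eq0 -lt0n.
have Q0 : 2 * (1 + l) ^+ d - 1 != 0.
  have : 1 <= (1 + l) ^+ d by rewrite exprn_ege1 // lerDl ltW.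
  by move=> Q1; apply: lt0r_neq0; lra.
by field; rewrite nG Z0 Q0 nd.
Qed.

End Deficit.

(** * Vanishing of the deficit for [K_{d,d}] *)

Section CompleteBipartite.
Variables (R : realType) (d : nat) (l : R).

Let side (x : Kbip d) : bool := if x is inl _ then true else false.

Let Kbip_adjE (x y : Kbip d) : adj x y = (side x != side y).
Proof. by case: x; case: y. Qed.

Lemma Kbip_regular : regular d (Kbip d).
Proof.
case=> i; rewrite -[RHS](card_ord d).
  rewrite -(card_imset 'I_d (@inr_inj 'I_d 'I_d)); apply: eq_card => -[j|j].
    by rewrite !inE; apply/esym/imsetP => -[].
  by rewrite !inE; apply/esym/imsetP; exists j.
rewrite -(card_imset 'I_d (@inl_inj 'I_d 'I_d)); apply: eq_card => -[j|j].
  by rewrite !inE; apply/esym/imsetP; exists j.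
by rewrite !inE; apply/esym/imsetP => -[].
Qed.

(** Every [J] lies on the side of [v]. If it is empty, all subsets of the opposite side are free;
    otherwise any of its vertices blocks that whole side. *)
Lemma local_deficit_Kbip (v : Kbip d) : local_deficit l v = 0.
Proof.
rewrite /local_deficit big1 // => J JN; apply/eqP; rewrite mulf_eq0; apply/orP; right.
have nJ x : x \in J -> side x = side v.
  by move=> /(subsetP JN); rewrite !inE Kbip_adjE negbK => /eqP.
have nK (K : {set Kbip d}) x : K \subset neighbours v -> x \in K -> side x = ~~ side v.
  by move=> KN /(subsetP KN); rewrite inE Kbip_adjE; case: (side v); case: (side x).
apply/eqP; have [->|[x xJ]] := set_0Vmem J.
  apply: gap_predT => K KN; rewrite /free_family set0U.
  apply/independentP => x y xK yK.
  by rewrite Kbip_adjE (nK _ _ KN xK) (nK _ _ KN yK) eqxx.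
apply: gap_pred0 => K KN /independentP iK; have [//|[y yK]] := set_0Vmem K.
have xI : x \in J :|: K by rewrite inE xJ.
have yI : y \in J :|: K by rewrite inE yK orbT.
by have := iK x y xI yI; rewrite Kbip_adjE (nJ _ xJ) (nK _ _ KN yK); case: (side v).
Qed.

End CompleteBipartite.

(** * From twin neighbourhoods to disjoint copies of [K_{d,d}] *)

Section TwinComponents.
Variables (d' : nat) (G : sgraph).
Let d := d'.+1.
Hypothesis reg : regular d G.
Hypothesis twins : forall u v w : G, adj u w -> adj v w -> neighbours u = neighbours v.

Let nonisolated (x : G) : exists w, adj x w.
Proof.
have /card_gt0P[w] : (0 < #|[set w | adj x w]|)%N by rewrite reg.
by rewrite inE; exists w.
Qed.

Definition twin_class (x : G) : {set G} := [set y | neighbours y == neighbours x].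

(** The two sides of the copy of [K_{d,d}] through [x], described without paths. *)
Definition component (x : G) : {set G} := twin_class x :|: neighbours x.

Lemma twin_class_neighbours x w : adj x w -> twin_class x = neighbours w.
Proof.
move=> xw; apply/setP => y; rewrite !inE; apply/eqP/idP => [/setP/(_ w)|wy].
  by rewrite !inE xw adj_sym.
by apply: (twins (w := w)) => //; rewrite adj_sym.
Qed.

Lemma card_component x : #|component x| = (d + d)%N.
Proof.
have [w xw] := nonisolated x.
rewrite /component cardsU (twin_class_neighbours xw) !reg.
suff -> : neighbours w :&: neighbours x = set0 by rewrite cards0 subn0.
apply/setP => y; rewrite !inE; apply/negbTE/negP => /andP[wy xy].
have /setP/(_ y) : neighbours x = neighbours y.
  by apply: (twins xw); rewrite adj_sym.
by rewrite !inE xy adj_irrefl.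
Qed.

Lemma component_refl x : x \in component x.
Proof. by rewrite !inE eqxx. Qed.

Lemma component_eq x y : y \in component x -> component y = component x.
Proof.
rewrite !inE => /orP[/eqP E|xy]; first by rewrite /component /twin_class E.
have yx : adj y x by rewrite adj_sym.
by rewrite /component (twin_class_neighbours xy) (twin_class_neighbours yx) setUC.
Qed.

Lemma adj_component x y : adj x y -> component x = component y.
Proof. by move=> xy; apply/esym/component_eq; rewrite !inE xy orbT. Qed.

Let comps := [set component x | x : G].

Lemma card_components : (#|comps| * (d + d))%N = #|G|.
Proof.
rewrite -cardsT; apply/esym/card_uniform_partition.
  by move=> _ /imsetP[x _ ->]; apply: card_component.
apply/and3P; split.
- rewrite eqEsubset subsetT /=; apply/subsetP => x _.
  by apply/bigcupP; exists (component x); [apply: imset_f | apply: component_refl].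
- apply/trivIsetP => _ _ /imsetP[x _ ->] /imsetP[y _ ->] /eqP neq.
  apply/pred0P => z /=; apply/negbTE/negP => /andP[/component_eq zx /component_eq zy].
  by apply: neq; rewrite -zx zy.
- apply/imsetP => -[x _ E]; have := component_refl x.
  by rewrite -E inE.
Qed.

Variable v0 : G.

(** The choice depends only on the set [component x], so equal components share it. As [x] lies in
    that set, the default [v0] is never reached. *)
Let rep (x : G) : G := odflt v0 [pick z in component x].

Let rep_in x : component (rep x) = component x.
Proof.
rewrite /rep; case: pickP => [z /component_eq //|/(_ x)].
by rewrite component_refl.
Qed.

(** Separates the twins of the representative from the rest of the component, which [sideF]
    identifies as its neighbours. *)
Let side x := neighbours x == neighbours (rep x).

Let sideF x : ~~ side x -> adj (rep x) x.
Proof.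
move=> sx; have := component_refl x; rewrite -rep_in !inE => /orP[E|//].
by rewrite /side E in sx.
Qed.

Let adjE x y : adj x y = (component x == component y) && (side x != side y).
Proof.
case: eqP => [E|nE] /=; last by apply/negP => /adj_component.
have rE : rep x = rep y by rewrite /rep E.
case sx: (side x); case sy: (side y) => /=.
- apply/negP => xy; have /setP/(_ y) := eqP sx; rewrite rE -(eqP sy) !inE xy.
  by rewrite adj_irrefl.
- have /setP/(_ y) := eqP sx; rewrite !inE => ->.
  by rewrite rE sideF ?sy.
- have /setP/(_ x) := eqP sy; rewrite adj_sym !inE => ->.
  by rewrite -rE sideF ?sx.
- apply/negP => xy; have := sideF (negbT sx); have := sideF (negbT sy).
  rewrite -rE !(adj_sym (rep x)) => yr xr.
  by have /setP/(_ y) := twins xr yr; rewrite !inE xy adj_irrefl.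
Qed.

Let twin_class_side x y :
  component x = component y -> side x = side y -> twin_class x = twin_class y.
Proof.
move=> E; have rE : rep x = rep y by rewrite /rep E.
case sx: (side x) => /esym sy.
  by rewrite /twin_class (eqP sx) rE (eqP sy).
have := sideF (negbT sx); have := sideF (negbT sy).
rewrite -rE !(adj_sym (rep x)) => yr xr.
by rewrite (twin_class_neighbours xr) (twin_class_neighbours yr).
Qed.

(** A twin class is the neighbourhood of some vertex, so it has [d] elements and [inord] does not
    truncate. *)
Let rank x : 'I_d := inord (index x (enum (twin_class x))).

Let rank_inj x y : twin_class x = twin_class y -> rank x = rank y -> x = y.
Proof.
have bound z : (index z (enum (twin_class z)) < d)%N.
  have [w zw] := nonisolated z; rewrite -(reg w) cardE.
  by rewrite -[[set _ | _]](twin_class_neighbours zw) index_mem mem_enum inE.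
have self z : z \in enum (twin_class z) by rewrite mem_enum inE.
move=> E /(congr1 val); rewrite /= !inordK // E => /(congr1 (nth v0 (enum (twin_class y)))).
by rewrite !nth_index ?self // -E self.
Qed.

Let comp0 : component v0 \in comps. Proof. exact: imset_f. Qed.

(* The two sides of a component are the twin classes of its members, so [rank]
   enumerates the side containing [x]. *)
Let code (x : G) : copies #|comps| (Kbip d) :=
  (enum_rank_in comp0 (component x),
   if side x then inl (rank x) else inr (rank x)).

Lemma twins_disjoint_union : disjoint_union_of (Kbip d) G.
Proof.
have codeC x y : ((code x).1 == (code y).1) = (component x == component y).
  by rewrite (inj_in_eq (@enum_rank_in_inj _ _ _ _ comp0 comp0)) ?imset_f.
exists #|comps|, code; last first.
  move=> x y; rewrite adjE /adj /= /copies_adj codeC; congr (_ && _).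
  by rewrite /code; case: (side x); case: (side y).
(* Both graphs have [#|comps| * (d + d)] vertices, so injectivity suffices. *)
apply: inj_card_bij; last by rewrite card_prod card_sum !card_ord card_components.
move=> x y E; have cE : component x = component y by apply/eqP; rewrite -codeC E.
have : (code x).2 = (code y).2 by rewrite E.
rewrite /code /=; case sx: (side x); case sy: (side y) => //= -[].
  by apply: rank_inj; apply: twin_class_side; rewrite ?sx.
by apply: rank_inj; apply: twin_class_side; rewrite ?sx.
Qed.

End TwinComponents.

(** * The bound, the extremal value and the case of equality *)

Theorem theorem1 (R : realType) (d : nat) (hd : (1 <= d)%N) (G : sgraph)
    (hG : (0 < #|G|)%N) (hreg : regular d G) (lambda : R) (hlambda : 0 < lambda) :
  [/\ occupancy G lambda <= occupancy (Kbip d) lambda,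
      occupancy (Kbip d) lambda =
        lambda * (1 + lambda) ^+ (d - 1) / (2 * (1 + lambda) ^+ d - 1)
    & occupancy G lambda = occupancy (Kbip d) lambda ->
        disjoint_union_of (Kbip d) G].
Proof.
have kG : (0 < #|Kbip d|)%N by rewrite card_sum card_ord addn_gt0 hd.
have Q1 : 0 < 2 * (1 + lambda) ^+ d - 1.
  have : 1 <= (1 + lambda) ^+ d by rewrite exprn_ege1 // lerDl ltW.
  by move=> Q1; lra.
have kE : occupancy (Kbip d) lambda =
    lambda * (1 + lambda) ^+ (d - 1) / (2 * (1 + lambda) ^+ d - 1).
  rewrite (occupancy_deficit hlambda hd (@Kbip_regular d) kG).
  by rewrite big1 ?mul0r ?subr0 // => v _; apply: local_deficit_Kbip.
have den0 : 0 < d%:R * (2 * (1 + lambda) ^+ d - 1) *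
    (#|G|%:R * \sum_(I : {set G} | independent I) lambda ^+ #|I|).
  by rewrite !mulr_gt0 ?ltr0n // partition_function_gt0.
split=> //; rewrite kE (occupancy_deficit hlambda hd hreg hG).
  rewrite gerBl divr_ge0 ?(ltW den0) //.
  by apply: sumr_ge0 => v _; apply: local_deficit_ge0.
move/eqP; rewrite -subr_eq0 addrAC subrr sub0r oppr_eq0 mulf_eq0 invr_eq0 (gt_eqF den0) orbF.
rewrite psumr_eq0 => [/allP D0|v _]; last exact: local_deficit_ge0.
have tight v := local_deficit_eq0 hlambda (eqP (D0 v (mem_index_enum v))).
case: d hd hreg {kG Q1 kE den0} => // d _ reg.
have /card_gt0P[v0 _] := hG; apply: twins_disjoint_union v0 => // u v w uw vw.
(* With nothing revealed, the single neighbour [u] of [w] is free, so tightness at [w] frees the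
   whole neighbourhood. *)
have NI : independent (neighbours w).
  have := tight w set0 [set u]; rewrite !set0U; apply.
  - exact: sub0set.
  - by rewrite sub1set inE adj_sym.
  - by apply/set0Pn; exists u; rewrite inE.
  - by apply/independentP => a b; rewrite !inE => /eqP -> /eqP ->; rewrite adj_irrefl.
have nuv : ~~ adj v u.
  by apply: (independentP _ NI); rewrite inE adj_sym.
(* Equal degrees reduce the claim to one inclusion. A neighbour [x] of [v] not adjacent to [u] would
   be free given [[set u]]; tightness at [v] would then make [[set u] :|: neighbours v] independent,
   against the edge from [u] to [w]. *)
apply/esym/eqP; rewrite eqEcard [#|neighbours u|]reg [#|neighbours v|]reg leqnn andbT; apply/subsetP => x.
rewrite !inE => vx; apply/negPn/negP => nux.
have iux : independent ([set u] :|: [set x]).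
  apply/independentP => a b; rewrite !inE => /orP[] /eqP -> /orP[] /eqP ->;
  by rewrite ?adj_irrefl // adj_sym.
have x0 : [set x] != set0 by apply/set0Pn; exists x; rewrite inE.
have := tight v [set u] [set x]; rewrite !sub1set !inE => /(_ nuv vx x0 iux).
by move=> /independentP/(_ u w); rewrite !inE eqxx vw uw orbT => /(_ isT isT).
Qed.
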